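(* Let $q=r^2$ where $r$ is an odd prime power, and let $q-1=e_1f_1=e_2f_2$ with positive integers $e_1,f_1,e_2,f_2$. Suppose there is an integer $l\geq 2$ with $e_1\equiv 2^l \pmod{2^{l+1}}$ and $2^l\mid e_2$. Suppose further that $2e_2\mid e_1(r-1)$ and $e_1\mid e_2(r+1)$. Let $D_1=\frac{e_1}{\gcd(e_1,e_2)}$, $D_2=\frac{e_2}{\gcd(e_1,e_2)}$, and let $s,t$ be integers with $1\leq s\leq D_1$, $1\leq t\leq D_2$ and $4\mid (s-1)(r+1)$. Put $n_1=sf_1+tf_2$. Then: (1) if $n_1$ is even, there exists a $q$-ary MDS self-dual code of length $n_1$; (2) if $n_1$ is odd, there exists a $q$-ary MDS self-dual code of length $n_1+1$; (3) if $n_1$ is even, there exists a $q$-ary MDS self-dual code of length $n_1+2$.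
   Context: $\mathbb{F}_q$ denotes the finite field with $q$ elements. A linear code of length $n$ over $\mathbb{F}_q$ is a subspace of $\mathbb{F}_q^n$; an $[n,k,d]$ code has dimension $k$ and minimum Hamming distance $d$, and it is MDS if $d=n-k+1$. The (Euclidean) dual of a code $C$ is $C^\perp=\{x\in\mathbb{F}_q^n : \sum_i x_ic_i=0 \text{ for all } c\in C\}$; $C$ is self-dual if $C=C^\perp$. A $q$-ary MDS self-dual code of length $n$ is a linear code over $\mathbb{F}_q$ of length $n$ that is both MDS and self-dual. *)

(* Defs.v *)
From HB Require Import structures.
From mathcomp Require Import all_boot all_order all_algebra all_field.
Set Implicit Arguments. Unset Strict Implicit. Unset Printing Implicit Defensive.
Import GRing.Theory.
Local Open Scope ring_scope.

Definition hweight (F : fieldType) (n : nat) (x : 'rV[F]_n) : nat :=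
  #|[set i : 'I_n | x 0 i != 0]|.

Definition edot (F : fieldType) (n : nat) (x y : 'rV[F]_n) : F :=
  \sum_(i < n) x 0 i * y 0 i.

Definition is_min_dist (F : finFieldType) (n : nat) (C : {vspace 'rV[F]_n}) (d : nat) : Prop :=
  (exists2 c, c \in C & (c != 0) && (hweight c == d)) /\
  (forall c, c \in C -> c != 0 -> (d <= hweight c)%N).

Definition is_MDS (F : finFieldType) (n : nat) (C : {vspace 'rV[F]_n}) : Prop :=
  exists d, is_min_dist C d /\ d = (n - \dim C + 1)%N.

Definition is_self_dual (F : finFieldType) (n : nat) (C : {vspace 'rV[F]_n}) : Prop :=
  forall x : 'rV[F]_n, x \in C <-> (forall c, c \in C -> edot x c = 0).

Definition exists_MDS_self_dual (F : finFieldType) (n : nat) : Prop :=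
  exists C : {vspace 'rV[F]_n}, is_MDS C /\ is_self_dual C.

(* Main.v *)
Require Import Defs.
From HB Require Import structures.
From mathcomp Require Import all_boot all_order all_algebra all_field.
From mathcomp Require Import cyclic zify ring.
Set Implicit Arguments. Unset Strict Implicit. Unset Printing Implicit Defensive.
Import GRing.Theory.
Local Open Scope ring_scope.

(* If P is the monic polynomial with a set A of n simple roots, and every
   P'(a) with a in A is a nonzero square, then the generalized Reed-Solomon code
   on A with column multipliers 1 / sqrt P'(a) (extended by the point at infinity
   when n is odd) is self-dual: by Lagrange interpolation, the sum over A of
   a^m / P'(a) vanishes for m < n - 1 and is 1 for m = n - 1.
   For w a primitive element of F_q, A is the union of the cosets
   w^(e2 i) <w^e1>, i < s, and w^(e1/2 + e1 j) <w^e2>, j < t, to which (3) adds 0.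
   With xi = w^(e2 f1) and delta = w^(e1/2 f2),
     P = prod_(i < s) (X^f1 - xi^i) * prod_(j < t) (X^f2 - delta^(2 j + 1)),
   and each P'(a) is a product of squares: delta lies in F_r, all of whose nonzero
   elements are squares in F_q, while xi^r = xi^-1 gives
   (xi^u + xi^v)^(r - 1) = xi^-(u + v), which xi^((r + 1)/2) = 1 turns into
   Euler's criterion; for xi^u - xi^v there is an extra sign (-1)^((r + 1)/2),
   cancelled by the hypothesis on s. *)

(** * Self-dual MDS codes from a generator matrix *)

Lemma hweight0 (F : fieldType) n : hweight (0 : 'rV[F]_n) = 0.
Proof. by apply: eq_card0 => i; rewrite inE mxE eqxx. Qed.

Lemma edotE (F : fieldType) n (x y : 'rV[F]_n) : edot x y = (x *m y^T) 0 0.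
Proof. by rewrite mxE; apply: eq_bigr => i _; rewrite mxE. Qed.

Lemma hweight_compl (F : fieldType) n (x : 'rV[F]_n) :
  (hweight x + #|[set i | x 0%R i == 0%R]| = n)%N.
Proof.
rewrite -[RHS](card_ord n) -(cardsC [set i | x 0 i != 0]); congr (_ + _)%N.
by apply: eq_card => i; rewrite !inE negbK.
Qed.

(** The weight bound makes [u *m G] injective in [u], so the code has dimension [k]; by
    [G *m G^T = 0] it lies in its dual, whose dimension is also [k]. The Singleton value of the
    distance is [k.+1]. *)
Lemma exists_MDS_self_dual_of_generator (F : finFieldType) (k : nat)
    (G : 'M[F]_(k, k.*2)) :
  (0 < k)%N -> G *m G^T = 0 ->
  (forall u : 'rV_k, u != 0 -> (k < hweight (u *m G))%N) ->
  exists_MDS_self_dual F k.*2.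
Proof.
move=> k_gt0 GG0 wG; pose f := linfun (mulmxr G : 'rV_k -> 'rV_k.*2).
have fE u : f u = u *m G by rewrite lfunE.
have mulG0 (u : 'rV_k) : u *m G = 0 -> u = 0.
  by move=> uG0; have [//|/wG] := eqVneq u 0; rewrite uG0 hweight0.
have memC x : reflect (exists u, x = u *m G) (x \in limg f).
  by apply: (iffP memv_imgP) => [[u _ ->]|[u ->]]; exists u; rewrite ?memvf ?fE.
have dimC : \dim (limg f) = k.
  rewrite limg_dim_eq ?dimvf /dim /= ?mul1n //.
  apply/eqP; rewrite -subv0; apply/subvP => u.
  rewrite memv_cap memvf memv_ker fE memv0 /= => /eqP /mulG0 ->.
  by rewrite eqxx.
have rankG : \rank G = k.
  by apply/eqP; apply: inj_row_free.
exists (limg f); split.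
- exists k.+1; split; last by rewrite dimC -addnn addnK addn1.
  split; last first.
    move=> c /memC [u ->] uG0; apply: wG.
    by apply: contraNneq uG0 => ->; rewrite mul0mx.
  (* Some nonzero [u] is orthogonal to the first [k - 1] columns, so [u *m G] has at least [k - 1]
     zeros and weight at most [k.+1]. *)
  have lek : (k.-1 <= k.*2)%N by lia.
  pose K := colsub (widen_ord lek) G.
  have [u uK u0] : exists2 u : 'rV_k, u *m K = 0 & u != 0.
    have : kermx K != 0.
      rewrite -mxrank_eq0 mxrank_ker subn_eq0 -ltnNge.
      by apply: leq_ltn_trans (rank_leq_col _) _; rewrite prednK.
    by case/rowV0Pn => u /sub_kermxP uK u0; exists u.
  exists (u *m G); first by apply/memC; exists u.
  apply/andP; split; first by apply: contraNneq u0 => /mulG0 ->.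
  rewrite eqn_leq wG // andbT.
  have := hweight_compl (u *m G).
  set Z := [set i | _].
  suff: (k.-1 <= #|Z|)%N by lia.
  rewrite -[leqLHS]card_ord -cardsT.
  have widen_inj : injective (widen_ord lek) by move=> i j e; apply/val_inj; case: e.
  rewrite -(card_imset _ widen_inj).
  apply/subset_leq_card/subsetP => _ /imsetP [i _ ->]; rewrite inE.
  apply/eqP; transitivity ((u *m K) 0 i); last by rewrite uK mxE.
  by rewrite !mxE; apply: eq_bigr => j _; rewrite !mxE.
- move=> x; split=> [/memC [u ->] c /memC [v ->]|ortho].
    by rewrite edotE trmx_mul mulmxA -(mulmxA u) GG0 mulmx0 mul0mx mxE.
  have sub : (G <= kermx G^T)%MS by apply/sub_kermxP.
  have eqG : (G == kermx G^T)%MS.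
    rewrite -(geq_leqif (mxrank_leqif_eq sub)) mxrank_ker mxrank_tr rankG.
    by lia.
  apply/memC; apply/submxP; rewrite (eqmxP eqG); apply/sub_kermxP/rowP => i.
  have Gi : row i G \in limg f.
    by apply/memC; exists (delta_mx 0 i); rewrite rowE.
  rewrite [RHS]mxE -[RHS](ortho _ Gi) mxE; apply: eq_bigr => j _.
  by rewrite !mxE.
Qed.

(** * Lagrange interpolation and generalized Reed-Solomon codes *)

Lemma deriv_prod_XsubC_rem (F : fieldType) (A : seq F) (a : F) : a \in A ->
  (\prod_(b <- A) ('X - b%:P))^`().[a] = (\prod_(b <- rem a A) ('X - b%:P)).[a].
Proof.
move=> aA; rewrite (perm_big _ (perm_to_rem aA)) big_cons /=.
by rewrite derivM derivXsubC !hornerE subrr mul0r addr0.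
Qed.

(** A repeated element is a multiple root and kills the derivative. The later conditions on
    derivatives thus already contain the disjointness of the cosets. *)
Lemma uniq_deriv_prod_XsubC (F : fieldType) (A : seq F) :
  {in A, forall a, (\prod_(b <- A) ('X - b%:P))^`().[a] != 0} -> uniq A.
Proof.
elim: A => //= a A IH nz; apply/andP; split.
  have := nz a (mem_head _ _); rewrite deriv_prod_XsubC_rem ?mem_head //= eqxx.
  by rewrite -[_ == 0]/(root _ a) root_prod_XsubC.
apply: IH => b bA; have := nz b; rewrite inE bA orbT => /(_ isT).
rewrite big_cons derivM derivXsubC hornerE mul1r.
have /eqP -> : (\prod_(c <- A) ('X - c%:P)).[b] == 0.
  by rewrite -[_ == 0]/(root _ b) root_prod_XsubC.
by rewrite add0r hornerM mulf_eq0 negb_or => /andP[].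
Qed.

(* The sum is the coefficient of degree [size A - 1] in the Lagrange interpolation of ['X^m]. *)
Lemma sum_exp_div_deriv (F : fieldType) (A : seq F) (m : nat) :
  let P := \prod_(b <- A) ('X - b%:P) in
  uniq A -> (m < size A)%N ->
  \sum_(a <- A) a ^+ m / P^`().[a] = (m.+1 == size A)%:R.
Proof.
move=> P uA ltm.
pose Q a := \prod_(b <- rem a A) ('X - b%:P).
have PQ a : a \in A -> P^`().[a] = (Q a).[a] by exact: deriv_prod_XsubC_rem.
have Qa0 a : (Q a).[a] != 0.
  by rewrite -[_ == 0]/(root _ a) root_prod_XsubC mem_rem_uniqF.
have sizeQ a : a \in A -> size (Q a) = size A.
  by move=> aA; rewrite size_prod_XsubC size_rem // prednK // (leq_ltn_trans _ ltm).
(* [R] is ['X^m] minus its interpolation polynomial: its degree is below [size A] and it vanishes on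
   [A], hence it is zero. *)
pose R := 'X^m - \sum_(a <- A) (a ^+ m / P^`().[a]) *: Q a.
have R0 : R = 0.
  have [//|nzR] := eqVneq R 0.
  have /(max_poly_roots nzR) /(_ uA) : all (root R) A.
    apply/allP => a aA; apply/rootP; rewrite /R hornerD hornerN hornerXn horner_sum.
    rewrite (bigD1_seq a) //= hornerZ PQ // divfK // big1_seq ?addr0 ?subrr //.
    move=> b /andP[ba bA]; rewrite hornerZ; apply/eqP; rewrite mulf_eq0; apply/orP; right.
    by rewrite -[_ == 0]/(root _ a) root_prod_XsubC mem_rem_uniq // inE eq_sym ba.
  rewrite ltnNge; case/negP.
  apply: leq_trans (size_polyD _ _) _; rewrite geq_max size_polyXn ltm size_polyN.
  rewrite big_seq; apply: (big_ind (fun p : {poly F} => size p <= size A)%N).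
  - by rewrite size_poly0.
  - by move=> p q hp hq; apply: leq_trans (size_polyD _ _) _; rewrite geq_max hp.
  - by move=> a aA; apply: leq_trans (size_scale_leq _ _) _; rewrite sizeQ.
have := congr1 (fun p : {poly F} => p`_(size A).-1) R0.
rewrite coef0 coefB coefXn coef_sum => /eqP; rewrite subr_eq0 => /eqP coefR.
transitivity (\sum_(a <- A) a ^+ m / P^`().[a] * (Q a)`_(size A).-1).
  rewrite big_seq [RHS]big_seq; apply: eq_bigr => a aA.
  by rewrite -(sizeQ a aA) -lead_coefE (monicP (monic_prod_XsubC _ _ _)) mulr1.
transitivity (\sum_(a <- A) ((a ^+ m / P^`().[a]) *: Q a)`_(size A).-1).
  by apply: eq_bigr => a _; rewrite coefZ.
by rewrite -coefR; congr (nat_of_bool _)%:R; lia.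
Qed.

(* Evaluation at the point at infinity, which picks the coefficient of degree
   [k - 1], is the last coordinate of the code when [size A = k.*2.-1]. *)
Lemma exists_MDS_self_dual_GRS (F : finFieldType) (A : seq F) (k : nat)
    (w : F -> F) (c : F) :
  let P := \prod_(b <- A) ('X - b%:P) in
  (0 < k)%N -> size A = k.*2 \/ size A = k.*2.-1 ->
  {in A, forall a, w a ^+ 2 * P^`().[a] = 1} -> c ^+ 2 = -1 ->
  exists_MDS_self_dual F k.*2.
Proof.
move=> P k_gt0 sizeA wP c2.
have P'0 a : a \in A -> P^`().[a] != 0.
  by move=> /wP /eqP; apply: contraTneq => ->; rewrite mulr0 eq_sym oner_eq0.
have w0 a : a \in A -> w a != 0.
  by move=> /wP /eqP; apply: contraTneq => ->; rewrite expr0n mul0r eq_sym oner_eq0.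
have c0 : c != 0.
  by move/eqP: c2; apply: contraTneq => ->; rewrite expr0n eq_sym oppr_eq0 oner_eq0.
have uA : uniq A := uniq_deriv_prod_XsubC P'0.
have wE a : a \in A -> w a ^+ 2 = (P^`().[a])^-1.
  by move=> aA; apply: (mulIf (P'0 a aA)); rewrite wP ?mulVf ?P'0.
pose g (i j : nat) := if (j < size A)%N then w A`_j * A`_j ^+ i else (i == k.-1)%:R * c.
pose G : 'M[F]_(k, k.*2) := \matrix_(i, j) g i j.
have le_size : (size A <= k.*2)%N by lia.
apply: (@exists_MDS_self_dual_of_generator _ _ G) => //.
- apply/matrixP => i i'; rewrite !mxE.
  have ltik := ltn_ord i; have lti'k := ltn_ord i'.
  transitivity (\sum_(0 <= j < k.*2) g i j * g i' j).
    by rewrite big_mkord; apply: eq_bigr => j _; rewrite !mxE.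
  rewrite (big_cat_nat (leq0n _) le_size) /=.
  have -> : \sum_(0 <= j < size A) g i j * g i' j = ((i + i').+1 == size A)%:R.
    rewrite -(sum_exp_div_deriv uA); last by case: sizeA => ->; lia.
    rewrite [RHS](big_nth 0); apply: eq_big_nat => j /= jA.
    rewrite /g jA exprD -wE ?mem_nth //; ring.
  case: sizeA => sizeA.
    rewrite sizeA big_geq // addr0.
    by rewrite (_ : _ == _ = false) //; apply/eqP; have := ltn_ord i; have := ltn_ord i'; lia.
  (* The sum over [A] is 1 exactly when [i] and [i'] are both [k.-1], and there infinity contributes
     [c ^+ 2 = -1]. *)
  have -> : k.*2 = (size A).+1 by lia.
  rewrite big_nat1 /g ltnn mulrACA -expr2 c2 -natrM mulnb mulrN1 sizeA.
  have -> : ((i + i').+1 == k.*2.-1) = ((i : nat) == k.-1) && ((i' : nat) == k.-1).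
    by have := ltn_ord i; have := ltn_ord i'; lia.
  by rewrite subrr.
(* A codeword evaluates [p], of degree below [k]; its zeros are roots of [p] in [A] and possibly
   infinity. *)
move=> u u0; pose p := rVpoly u.
have p0 : p != 0 by apply: contraNneq u0 => p0; rewrite -[u]rVpolyK -/p p0 linear0.
have sizep : (size p <= k)%N by exact: size_poly.
have pcoef (i : 'I_k) : p`_i = u 0 i by rewrite coef_rVpoly_ord.
have evalA (j : 'I_k.*2) : (j < size A)%N -> (u *m G) 0 j = w A`_j * p.[A`_j].
  move=> jA; rewrite mxE (horner_coef_wide _ sizep) mulr_sumr.
  apply: eq_bigr => i _; rewrite mxE /g jA pcoef; ring.
have evaloo (j : 'I_k.*2) : (size A <= j)%N -> (u *m G) 0 j = p`_k.-1 * c.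
  move=> jA; have kk : (k.-1 < k)%N by rewrite prednK.
  rewrite mxE (bigD1 (Ordinal kk)) //= mxE /g ltnNge jA /= eqxx mul1r.
  rewrite -(pcoef (Ordinal kk)) big1 ?addr0 // => i neq.
  rewrite mxE /g ltnNge jA /= (_ : _ == _ = false) ?mul0r ?mulr0 //.
  by apply: contraNF neq => /eqP e; apply/eqP/val_inj.
have := hweight_compl (u *m G).
set Z := [set i | _].
suff: (#|Z| < k)%N by lia.
pose roots := [seq a <- A | root p a].
have roots_lt : (size roots < size p)%N.
  by apply: max_poly_roots p0 _ (filter_uniq _ uA); apply/allP => a; rewrite mem_filter => /andP[].
have Zfin : (#|[set j in Z | j < size A]| <= size roots)%N.
  rewrite cardE -(size_map (fun j : 'I_k.*2 => A`_j)).
  apply: uniq_leq_size.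
    rewrite map_inj_in_uniq ?enum_uniq // => i j.
    rewrite !mem_enum !inE => /andP[_ iA] /andP[_ jA] /eqP.
    by rewrite nth_uniq // => /eqP /val_inj.
  move=> _ /mapP[j + ->]; rewrite mem_enum !inE => /andP[z jA].
  rewrite mem_filter mem_nth // andbT; move: z; rewrite evalA // mulf_eq0.
  by rewrite (negPf (w0 _ _)) ?mem_nth.
(* A zero at infinity lowers the degree bound on [p] by one, which makes up for the extra zero. *)
have [[j jZ jA]|noZ] : (exists2 j, j \in Z & size A <= j)%N \/ {in Z, forall j : 'I_k.*2, j < size A}%N.
- have [/existsP[j /andP[jZ jA]]|] := boolP [exists j in Z, (size A <= j)%N].
    by left; exists j.
  by move/exists_inPn => noZ; right => j /noZ; rewrite -ltnNge.
- have pk : p`_k.-1 = 0.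
    move: jZ; rewrite inE evaloo // mulf_eq0 (negPf c0) orbF => /eqP //.
  have ltp : (size p < k)%N.
    rewrite -[ltnRHS](prednK k_gt0) ltnS; apply/leq_sizeP => i.
    rewrite leq_eqVlt => /predU1P[<- //|lti].
    by apply: nth_default; apply: leq_trans sizep _; lia.
  have Zsub : Z \subset j |: [set j in Z | j < size A]%N.
    apply/subsetP => i iZ; rewrite in_setU1 inE iZ /=.
    have [//|iA] := ltnP i (size A); first by rewrite orbT.
    rewrite orbF; apply/eqP/val_inj; have := ltn_ord i; have := ltn_ord j; move=> /=; lia.
  apply: leq_ltn_trans (subset_leq_card Zsub) _.
  by rewrite cardsU1; case: (_ \notin _); lia.
- have Zsub : Z \subset [set j in Z | j < size A]%N.
    by apply/subsetP => i iZ; rewrite inE iZ noZ.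
  by have := subset_leq_card Zsub; lia.
Qed.

(** * Roots of unity and squares in a finite field *)

Lemma finField_prim_root (F : finFieldType) : exists w : F, #|F|.-1.-primitive_root w.
Proof.
pose rs := [seq x <- enum F | x != 0].
have : has #|F|.-1.-primitive_root rs.
  apply: has_prim_root; first by rewrite -subn1 subn_gt0 finNzRing_gt1.
  - apply/allP => x; rewrite mem_filter mem_enum => /andP[x0 _].
    apply/unity_rootP; apply: (mulfI x0).
    by rewrite -exprS prednK ?mulr1 ?expf_card // ltnW // finNzRing_gt1.
  - exact: filter_uniq (enum_uniq F).
  - rewrite -(cardC1 (0 : F)) cardE; apply: uniq_leq_size (enum_uniq _) _ => x.
    by rewrite mem_enum mem_filter mem_enum andbT.
by case/hasP => w _; exists w.
Qed.

(** Euler's criterion: for [z = w ^+ i] with [w] primitive, [z ^+ h = 1] forces [i] to be even. *)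
Lemma prim_root_half_square (F : finFieldType) (h : nat) (z : F) :
  #|F|.-1 = h.*2 -> z ^+ h = 1 -> exists w, w ^+ 2 = z.
Proof.
move=> cardF zh; have [w prim_w] := finField_prim_root F.
rewrite cardF in prim_w.
have h_gt0 : (0 < h)%N by have := prim_order_gt0 prim_w; lia.
have [|i zE] := prim_rootP prim_w (x := z).
  by rewrite -mul2n mulnC exprM zh expr1n.
have : (2 * h %| i * h)%N by rewrite mul2n (prim_order_dvd prim_w) exprM -zE zh.
rewrite dvdn_pmul2r // => /dvdnP[j ij].
by exists (w ^+ j); rewrite -exprM -ij.
Qed.

(** This places the integer factors [f1] and [f2] of the derivatives in the subfield fixed by
    Frobenius. *)
Lemma natr_exp_frobenius (R : nzRingType) (r n : nat) :
  (0 < r)%N -> (forall x y : R, (x + y) ^+ r = x ^+ r + y ^+ r) -> n%:R ^+ r = n%:R :> R.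
Proof.
move=> r0 frob; elim: n => [|n IH]; first by rewrite expr0n gtn_eqF.
by rewrite -natr1 frob IH expr1n.
Qed.

(** * The polynomial of a union of cosets *)

Lemma prod_XsubC_geometric (F : fieldType) (n : nat) (z b : F) :
  n.-primitive_root z ->
  \prod_(u <- iota 0 n) ('X - (b * z ^+ u)%:P) = 'X^n - (b ^+ n)%:P.
Proof.
move=> prim_z; have n_gt0 := prim_order_gt0 prim_z.
have [->|b0] := eqVneq b 0.
  rewrite expr0n gtn_eqF //= subr0.
  under eq_bigr do rewrite mul0r subr0.
  by rewrite big_const_seq count_predT size_iota -Monoid.iteropE.
pose rs := [seq b * z ^+ u | u <- iota 0 n].
have prodE : \prod_(u <- iota 0 n) ('X - (b * z ^+ u)%:P) =
    \prod_(x <- rs) ('X - x%:P) by rewrite big_map.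
rewrite prodE [RHS](@all_roots_prod_XsubC _ ('X^n - (b ^+ n)%:P) rs).
- by rewrite lead_coefDl ?lead_coefXn ?scale1r // size_polyN size_polyC size_polyXn; case: (_ != 0).
- by rewrite size_XnsubC // size_map size_iota.
- apply/allP => _ /mapP[u _ ->]; apply/rootP.
  by rewrite !hornerE exprMn exprAC (prim_expr_order prim_z) expr1n mulr1 subrr.
- rewrite uniq_rootsE map_inj_in_uniq ?iota_uniq // => u v.
  rewrite !mem_iota /= !add0n => ltu ltv /(mulfI b0) /eqP.
  by rewrite (eq_prim_root_expr prim_z) !modn_small // => /eqP.
Qed.

Lemma deriv_prod_Xn_subC (F : fieldType) (n s : nat) (c : nat -> F) (k : 'I_s) (a : F) :
  a ^+ n = c k ->
  (\prod_(i < s) ('X^n - (c i)%:P))^`().[a] =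
  n%:R * a ^+ n.-1 * \prod_(i < s | i != k) (c k - c i).
Proof.
move=> ak; rewrite (bigD1 k) //= derivM hornerD !hornerM.
rewrite derivB derivC derivXn subr0 hornerMn !hornerE ak subrr mul0r addr0 horner_prod.
rewrite -mulr_natl; congr (_ * _); apply: eq_bigr => i _.
by rewrite !hornerE ak.
Qed.

(** Here [x ^+ r] and [y ^+ r] are the inverses of [x] and [y], so
    [(x + y) ^+ r = (x + y) / (x * y)]. *)
Lemma add_exp_frobenius_inv (F : fieldType) (r : nat) (x y : F) :
  (0 < r)%N -> (x + y) ^+ r = x ^+ r + y ^+ r -> x ^+ r.+1 = 1 -> y ^+ r.+1 = 1 -> x + y != 0 ->
  (x + y) ^+ r.-1 * (x * y) = 1.
Proof.
move=> r0 frob xr yr xy0; apply: (mulfI xy0).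
rewrite [LHS]mulrA -exprS prednK // frob mulr1 mulrDl mulrA -exprSr xr mul1r.
by rewrite mulrCA -exprSr yr mulr1 addrC.
Qed.

Lemma prod_exp_eq1 (R : comNzRingType) (I : finType) (P : pred I) (E : I -> R) (h : nat) :
  (forall i, P i -> E i ^+ h = 1) -> (\prod_(i | P i) E i) ^+ h = 1.
Proof. by move=> E1; rewrite -prodrXl; apply: big1. Qed.

(* Here [h = (r ^ 2 - 1) / 2], so [z ^+ h = 1] says that [z] is a nonzero square. *)
Lemma union_cosets_deriv_exp_half (F : fieldType) (r k f1 f2 s t : nat)
    (alpha beta gamma : F) (h := (r.-1 * k)%N) (xi := beta ^+ f1) (delta := gamma ^+ f2) :
  (forall x y : F, (x + y) ^+ r = x ^+ r + y ^+ r) -> r.+1 = k.*2 ->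
  f1.-primitive_root alpha -> f2.-primitive_root beta ->
  alpha ^+ h = 1 -> beta ^+ h = 1 -> gamma ^+ h = 1 ->
  f1%:R != 0 :> F -> f2%:R != 0 :> F ->
  gamma ^+ f1 = -1 -> delta ^+ 2 = alpha ^+ f2 ->
  xi ^+ k = 1 -> delta ^+ r.-1 = 1 -> (-1 : F) ^+ (s.-1 * k) = 1 ->
  {in gtn s &, injective (fun i => xi ^+ i)} ->
  {in gtn t &, injective (fun j => delta ^+ j.*2.+1)} ->
  (forall i v, xi ^+ v + xi ^+ i != 0) ->
  (forall u j, delta ^+ u.*2 != delta ^+ j.*2.+1) ->
  exists2 A : seq F, size A = (s * f1 + t * f2)%N &
    let P := \prod_(b <- A) ('X - b%:P) in
    P.[0] ^+ h = 1 /\ {in A, forall a, a ^+ h = 1 /\ P^`().[a] ^+ h = 1}.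
Proof.
move=> frob rk prim_a prim_b ah bh ch f1nz f2nz cf1 d2 xik dr sgn inj_xi inj_d xi_xi d_d.
have k_gt0 : (0 < k)%N by lia.
have r_gt0 : (0 < r)%N by lia.
have f1_gt0 := prim_order_gt0 prim_a.
have f2_gt0 := prim_order_gt0 prim_b.
have even_exp (z : F) : z ^+ r.+1 = (z ^+ k) ^+ 2 by rewrite -exprM rk muln2.
have frobN (x : F) : (- x) ^+ r = - x ^+ r.
  by apply/eqP; rewrite -addr_eq0 -frob addNr expr0n gtn_eqF.
have h_of_fixed (z : F) : z ^+ r = z -> z != 0 -> z ^+ h = 1.
  move=> zr z0; rewrite exprM (_ : z ^+ r.-1 = 1) ?expr1n //.
  by apply: (mulfI z0); rewrite -exprS prednK // zr mulr1.
have N1h : (-1 : F) ^+ h = 1 by apply: h_of_fixed; rewrite ?frobN ?expr1n // oppr_eq0 oner_eq0.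
have nat_h n : n%:R != 0 :> F -> (n%:R : F) ^+ h = 1.
  by apply: h_of_fixed; apply: natr_exp_frobenius.
have dfix n : (delta ^+ n) ^+ r = delta ^+ n.
  by rewrite -(prednK r_gt0) exprS -exprM mulnC exprM dr expr1n mulr1.
have dh n : (delta ^+ n) ^+ h = 1 by rewrite exprAC (exprM delta) dr !expr1n.
have dsub_h m n : delta ^+ m != delta ^+ n -> (delta ^+ m - delta ^+ n) ^+ h = 1.
  by move=> mn; apply: h_of_fixed; rewrite ?subr_eq0 // frob frobN !dfix.
have xikn n : (xi ^+ n) ^+ k = 1 by rewrite exprAC xik expr1n.
have xirn n : (xi ^+ n) ^+ r.+1 = 1 by rewrite even_exp xikn expr1n.
have xih n : (xi ^+ n) ^+ h = 1 by rewrite /h mulnC exprM xikn expr1n.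
(* Taking [k]-th powers in [add_exp_frobenius_inv] removes the product, since [xi ^+ k = 1]. *)
have xiadd_h m n : (xi ^+ m + xi ^+ n) ^+ h = 1.
  have := add_exp_frobenius_inv r_gt0 (frob _ _) (xirn m) (xirn n) (xi_xi _ _).
  by move/(congr1 (fun z : F => z ^+ k)); rewrite !exprMn !xikn !mulr1 expr1n -exprM.
(* With [- xi ^+ n] as second summand, the [k]-th power leaves the sign [(-1) ^+ k]. *)
have xisub_h m n : xi ^+ m != xi ^+ n -> (xi ^+ m - xi ^+ n) ^+ h = (-1) ^+ k.
  rewrite -subr_eq0 => mn.
  have xiN : (- xi ^+ n) ^+ r.+1 = 1.
    by rewrite even_exp exprNn xikn mulr1 sqrr_sign.
  have := add_exp_frobenius_inv r_gt0 (frob _ _) (xirn m) xiN mn.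
  move=> /(congr1 (fun z : F => z ^+ k)).
  rewrite !exprMn (exprNn (xi ^+ n)) !xikn  mul1r mulr1 expr1n -exprM => /(congr1 (fun z => z * (-1) ^+ k)).
  by rewrite -mulrA -expr2 sqrr_sign mulr1 mul1r.
pose A1 := [seq beta ^+ i * alpha ^+ u | i <- iota 0 s, u <- iota 0 f1].
pose A2 := [seq gamma * alpha ^+ j * beta ^+ v | j <- iota 0 t, v <- iota 0 f2].
pose P1 := \prod_(i < s) ('X^f1 - (xi ^+ i)%:P).
pose P2 := \prod_(j < t) ('X^f2 - (delta ^+ j.*2.+1)%:P).
have P1E : \prod_(b <- A1) ('X - b%:P) = P1.
  rewrite big_allpairs_dep /P1 -(big_mkord xpredT (fun i => 'X^f1 - (xi ^+ i)%:P)) /index_iota subn0.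
  by apply: eq_bigr => i _; rewrite (prod_XsubC_geometric _ prim_a) exprAC.
have dE j : delta ^+ j.*2.+1 = (gamma * alpha ^+ j) ^+ f2.
  by rewrite exprMn (exprAC alpha) -d2 -exprM mul2n exprS.
have P2E : \prod_(b <- A2) ('X - b%:P) = P2.
  rewrite big_allpairs_dep /P2 -(big_mkord xpredT (fun j => 'X^f2 - (delta ^+ j.*2.+1)%:P)) /index_iota subn0.
  by apply: eq_bigr => i _; rewrite (prod_XsubC_geometric _ prim_b) dE.
exists (A1 ++ A2); first by rewrite size_cat !size_allpairs !size_iota.
have P1c (a : F) (c : F) : a ^+ f1 = c -> P1.[a] = \prod_(i < s) (c - xi ^+ i).
  by move=> <-; rewrite horner_prod; apply: eq_bigr => i _; rewrite !hornerE.
have P2c (a : F) (c : F) : a ^+ f2 = c -> P2.[a] = \prod_(j < t) (c - delta ^+ j.*2.+1).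
  by move=> <-; rewrite horner_prod; apply: eq_bigr => i _; rewrite !hornerE.
rewrite big_cat /= P1E P2E; split.
  (* The value at 0 is the derivative of ['X * P] there, for the case where 0 joins the roots; its
     factors are negated powers of [xi] and [delta]. *)
  rewrite hornerM (@P1c 0 0) ?(@P2c 0 0) ?expr0n ?gtn_eqF // exprMn.
  rewrite !prod_exp_eq1 ?mulr1 // => i _.
  - by rewrite sub0r exprNn N1h dh mulr1.
  - by rewrite sub0r exprNn N1h xih mulr1.
have expXh (z : F) n : z ^+ h = 1 -> (z ^+ n) ^+ h = 1 by move=> zh; rewrite exprAC zh expr1n.
move=> a; rewrite mem_cat => /orP[] /allpairsP[[i u] /= []]; rewrite !mem_iota !add0n /=.
- move=> lti ltu aE.
  have ah1 : a ^+ h = 1 by rewrite aE exprMn !expXh ?mulr1.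
  have af1 : a ^+ f1 = xi ^+ Ordinal lti.
    by rewrite aE exprMn exprAC (exprAC alpha) (prim_expr_order prim_a) expr1n mulr1.
  have af2 : a ^+ f2 = delta ^+ u.*2.
    by rewrite aE exprMn exprAC (prim_expr_order prim_b) expr1n mul1r exprAC -d2 -exprM mul2n.
  split=> //; rewrite derivM hornerD !hornerM.
  have -> : P1.[a] = 0.
    by rewrite (P1c _ _ af1) (bigD1 (Ordinal lti)) //= subrr mul0r.
  rewrite mul0r addr0 (deriv_prod_Xn_subC af1) (P2c _ _ af2) !exprMn nat_h // expXh // !mul1r.
  (* Each of the [s.-1] differences contributes [(-1) ^+ k]; [sgn] makes the total sign 1. *)
  rewrite -prodrXl (eq_bigr (fun=> (-1) ^+ k)); last first.
    move=> j ji; rewrite xisub_h //; apply: contra ji => /eqP /inj_xi e; apply/eqP/val_inj.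
    by symmetry; apply: e; rewrite inE /=.
  rewrite prodr_const cardC1 card_ord -exprM mulnC sgn mul1r.
  by apply: prod_exp_eq1 => j _; apply: dsub_h.
- move=> lti ltu aE.
  have ah1 : a ^+ h = 1 by rewrite aE !exprMn ch !expXh ?mulr1.
  have af1 : a ^+ f1 = - xi ^+ u.
    by rewrite aE !exprMn cf1 exprAC (prim_expr_order prim_a) expr1n mulr1 mulN1r exprAC.
  have af2 : a ^+ f2 = delta ^+ (Ordinal lti).*2.+1.
    by rewrite aE exprMn -dE (exprAC beta) (prim_expr_order prim_b) expr1n mulr1.
  split=> //; rewrite derivM hornerD !hornerM.
  have -> : P2.[a] = 0.
    by rewrite (P2c _ _ af2) (bigD1 (Ordinal lti)) //= subrr mul0r.
  rewrite mulr0 add0r (P1c _ _ af1).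
  rewrite (@deriv_prod_Xn_subC _ _ _ (fun j => delta ^+ j.*2.+1) (Ordinal lti)) //.
  rewrite !exprMn nat_h // expXh // !mul1r !prod_exp_eq1 ?mulr1 // => j.
    move=> ji; apply: dsub_h; apply: contra ji => /eqP /inj_d e; apply/eqP/val_inj.
    by symmetry; apply: e; rewrite inE /=.
  (* On these cosets [a ^+ f1 = - xi ^+ u], so the factors of [P1] are sums up to sign. *)
  by move=> _; rewrite -opprD exprNn N1h mul1r xiadd_h.
Qed.

(** * Square derivatives and the arithmetic of the exponents *)

Lemma exists_MDS_self_dual_half (F : finFieldType) (A : seq F) (h k : nat) :
  let P := \prod_(b <- A) ('X - b%:P) in
  #|F|.-1 = h.*2 -> ~~ odd h -> (0 < k)%N -> size A = k.*2 \/ size A = k.*2.-1 ->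
  {in A, forall a, P^`().[a] ^+ h = 1} -> exists_MDS_self_dual F k.*2.
Proof.
move=> P cardF even_h k_gt0 sizeA P'h.
have h_gt0 : (0 < h)%N.
  by rewrite -double_gt0 -cardF -subn1 subn_gt0 finNzRing_gt1.
(* Evenness of [h] makes -1 a square, which provides the multiplier at infinity. *)
have [|c c2] := @prim_root_half_square F h (-1) cardF; first by rewrite -signr_odd (negPf even_h).
(* The multiplier is a square root of [1 / P'(a)]; Euler's criterion shows that the choice succeeds
   on [A], so the default 0 never occurs there. *)
apply: (@exists_MDS_self_dual_GRS F A k (fun a => odflt 0 [pick w | w ^+ 2 * P^`().[a] == 1]) c) => //.
move=> a aA; case: pickP => [w /eqP //|noroot].
have nz : P^`().[a] != 0.
  by apply/eqP => z; have := P'h a aA; rewrite z expr0n gtn_eqF // => /eqP; rewrite eq_sym oner_eq0.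
have [|w w2] := prim_root_half_square (z := (P^`().[a])^-1) cardF.
  by rewrite exprVn P'h // invr1.
by have := noroot w; rewrite w2 mulVf ?eqxx.
Qed.

(** The elements [alpha], [beta], [gamma] become [w ^+ e1], [w ^+ e2], [w ^+ (e1 / 2)] for a
    primitive [w], which turns the equations on their powers into divisibilities by
    [q - 1 = 2 h]. *)
Lemma exists_union_cosets_deriv_exp_half (F : finFieldType) (p m r e1 f1 e2 f2 l s t : nat) :
  prime p -> odd p -> (0 < m)%N -> r = (p ^ m)%N -> #|F| = (r ^ 2)%N ->
  (r ^ 2 - 1)%N = (e1 * f1)%N -> (r ^ 2 - 1)%N = (e2 * f2)%N ->
  (2 <= l)%N -> e1 = 2 ^ l %[mod 2 ^ l.+1] -> (2 ^ l %| e2)%N ->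
  (2 * e2 %| e1 * (r - 1))%N -> (e1 %| e2 * (r + 1))%N ->
  (s <= e1 %/ gcdn e1 e2)%N -> (t <= e2 %/ gcdn e1 e2)%N ->
  (4 %| (s - 1) * (r + 1))%N ->
  exists h, [/\ #|F|.-1 = h.*2, ~~ odd h &
    exists2 A : seq F, size A = (s * f1 + t * f2)%N &
    let P := \prod_(b <- A) ('X - b%:P) in
    P.[0] ^+ h = 1 /\ {in A, forall a, a ^+ h = 1 /\ P^`().[a] ^+ h = 1}].
Proof.
move=> pr_p odd_p m_gt0 rE cardF N1 N2 l_ge2 e1_mod e2_dvd e2_e1 e1_e2 s_le t_le sgn.
have odd_r : odd r by rewrite rE oddX odd_p orbT.
have r_gt1 : (1 < r)%N by rewrite rE -(exp1n m) ltn_exp2r // prime_gt1.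
pose k := (r.+1)./2; have rk : r.+1 = k.*2 by rewrite /k even_halfK //= odd_r.
pose h := (r.-1 * k)%N.
have even_h : ~~ odd h by rewrite /h oddM -subn1 oddB ?odd_r // ltnW.
have hN : (r ^ 2 - 1 = h.*2)%N.
  by rewrite -[1%N in LHS](exp1n 2) subn_sqr subn1 addn1 rk -doubleMr.
have cardN : #|F|.-1 = h.*2 by rewrite cardF -hN subn1.
exists h; split=> //.
have pcharF : p \in [pchar F].
  by apply: (@card_finPcharP _ _ (m * 2)) => //; rewrite cardF rE expnM.
have frob (x y : F) : (x + y) ^+ r = x ^+ r + y ^+ r.
  by apply: exprDn_pchar; rewrite (eq_pnat _ (pcharf_eq pcharF)) rE pnatX pnat_id.
(* Since [q] is zero in [F], a vanishing [f] would give [-1 = 0]. *)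
have nat_nz f e : (r ^ 2 - 1 = e * f)%N -> f%:R != 0 :> F.
  move=> Nef; apply/eqP => f0; have /eqP := natrM F e f.
  rewrite f0 mulr0 -Nef natrB ?expn_gt0 ?(ltnW r_gt1) // rE -expnM natrX.
  by rewrite (pcharf0 pcharF) expr0n muln_eq0 orbF gtn_eqF // sub0r oppr_eq0 oner_eq0.
have [w prim_w] := finField_prim_root F; rewrite cardN in prim_w.
have h_gt0 : (0 < h)%N by rewrite -double_gt0 (prim_order_gt0 prim_w).
have w1 n : (w ^+ n = 1) <-> (h.*2 %| n)%N.
  by rewrite (prim_order_dvd prim_w); split=> /eqP.
have wh : w ^+ h = -1.
  have : w ^+ h ^+ 2 == 1 by rewrite -exprM muln2 (prim_expr_order prim_w).
  rewrite sqrf_eq1 => /orP[/eqP/w1|/eqP //].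
  by rewrite gtnNdvd // -addnn -{1}[h]addn0 ltn_add2l.
have wN1 : (-1 : F) != 1.
  by rewrite -wh; apply/eqP => /w1; rewrite gtnNdvd // -addnn -{1}[h]addn0 ltn_add2l.
(* Set [2 ^ l = 4 * W]: then [e1] is [4 * W] times an odd number, and [e2] a multiple of [4 * W]. *)
have [W WE] : exists W, (2 ^ l = 4 * W)%N.
  by exists (2 ^ (l - 2))%N; rewrite -[4%N]/(2 ^ 2)%N -expnD subnKC.
have W_gt0 : (0 < W)%N by have := expn_gt0 2 l; rewrite WE muln_gt0.
have [x e2E] : exists x, e2 = (4 * W * x)%N.
  by case/dvdnP: e2_dvd => x ->; exists x; rewrite WE mulnC.
have [a e1E] : exists a, e1 = (4 * W * a.*2.+1)%N.
  exists (e1 %/ 2 ^ l.+1)%N; rewrite {1}(divn_eq e1 (2 ^ l.+1)) e1_mod.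
  by rewrite modn_small ?ltn_exp2l // expnS WE; move: (e1 %/ _)%N => ?; clear; lia.
(* [c = e1 / 2], so that [w ^+ c] is the shift [gamma] with [gamma ^+ f1 = -1]. *)
pose c := (2 * W * a.*2.+1)%N.
have e1c : e1 = c.*2 by rewrite e1E /c -muln2; clear; lia.
have cf1 : (c * f1 = h)%N by move: N1; rewrite hN e1c -doubleMl => /double_inj.
have f1_gt0 : (0 < f1)%N by move: h_gt0; rewrite -cf1 muln_gt0 => /andP[].
have N_gt0 : (0 < r ^ 2 - 1)%N by rewrite hN double_gt0.
have f2_gt0 : (0 < f2)%N by move: N_gt0; rewrite N2 muln_gt0 => /andP[].
have hxa : (c * f2 * x = h * a.*2.+1)%N.
  apply: double_inj; rewrite (doubleMl h) -hN N2 e2E /c -!muln2; clear; lia.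
have prim_pow e f : (r ^ 2 - 1 = e * f)%N -> f.-primitive_root (w ^+ e).
  move=> Nef; have f_gt0 : (0 < f)%N by move: N_gt0; rewrite Nef muln_gt0 => /andP[].
  have := @dvdn_prim_root _ _ _ prim_w f; rewrite -hN Nef mulnK //.
  by apply; apply: dvdn_mull.
(* Two facts keep the cosets apart: [xi] has odd order, and [delta ^+ x = -1]. *)
have xD : (w ^+ e2 ^+ f1) ^+ a.*2.+1 = 1.
  rewrite -!exprM; apply/w1; apply/dvdnP; exists x; rewrite -hN N1 e1E e2E; clear; lia.
have dx : (w ^+ c ^+ f2) ^+ x = -1.
  by rewrite -!exprM mulnA hxa exprM wh -signr_odd /= odd_double.
have sgn1 n : (-1 : F) ^+ n.*2 = 1 by rewrite -mul2n exprM sqrrN !expr1n.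
(* This gives the order of [xi] and, with the indices exchanged, that of [delta ^+ 2]; they bound
   [s] and [t]. *)
have prim_pow2 e1' f1' e2' f2' : (r ^ 2 - 1 = e1' * f1')%N -> (r ^ 2 - 1 = e2' * f2')%N ->
    (e1' %/ gcdn e1' e2').-primitive_root (w ^+ (e2' * f1')).
  move=> N1' N2'; have := exp_prim_root prim_w (e2' * f1').
  have f1'_gt0 : (0 < f1')%N by move: N_gt0; rewrite N1' muln_gt0 => /andP[].
  by rewrite -hN N1' -muln_gcdl divnMr // gcdnC.
apply: (@union_cosets_deriv_exp_half F r k f1 f2 s t (w ^+ e1) (w ^+ e2) (w ^+ c)) => //.
- exact: prim_pow N1.
- exact: prim_pow N2.
- by rewrite -exprM; apply/w1/dvdnP; exists c; rewrite -/h e1c -!muln2; clear; lia.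
- by rewrite -exprM; apply/w1/dvdnP; exists (2 * W * x)%N; rewrite -/h e2E -!muln2; clear; lia.
- by rewrite -exprM; apply/w1/dvdnP; exists (W * a.*2.+1)%N; rewrite -/h /c -!muln2; clear; lia.
- exact: nat_nz N1.
- exact: nat_nz N2.
- by rewrite -exprM cf1.
- by rewrite -!exprM; congr (w ^+ _); rewrite e1c -muln2; clear; lia.
(* After cancelling [4 * W] from [e1 %| e2 * (2 * k)], the odd divisor [a.*2.+1] allows the factor 2
   to be dropped. *)
- rewrite -!exprM; apply/w1; rewrite -hN N1 mulnA mulnAC dvdn_pmul2r //.
  move: e1_e2; rewrite addn1 rk e1E e2E -!mulnA !dvdn_pmul2l //.
  rewrite -(muln2 k) mulnA Gauss_dvdl // coprimen2 /= odd_double.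
  by [].
- rewrite -!exprM; apply/w1; rewrite -hN N2 mulnA mulnAC dvdn_pmul2r //.
  by move: e2_e1; rewrite e1c -mul2n -mulnA dvdn_pmul2l // subn1.
- have : (2 %| s.-1 * k)%N.
    by move: sgn; rewrite addn1 rk subn1 -[4%N]/(2 * 2)%N -mul2n mulnCA dvdn_pmul2l.
  by case/dvdnP=> n ->; rewrite muln2 sgn1.
- move=> i j lti ltj /= /eqP.
  rewrite -(exprM w) (eq_prim_root_expr (prim_pow2 _ _ _ _ N1 N2)).
  rewrite !modn_small; [by move=> /eqP| |]; apply: leq_trans s_le => //.
- move=> i j lti ltj /=; rewrite !exprS => /mulfI.
  have d0 : w ^+ c ^+ f2 != 0.
    by rewrite !expf_neq0 //; apply: contra_eq_neq wh => ->; rewrite expr0n gtn_eqF // eq_sym oppr_eq0 oner_eq0.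
  have d2 : w ^+ c ^+ f2 ^+ 2 = w ^+ (e1 * f2).
    by rewrite -!exprM; congr (w ^+ _); rewrite e1c -muln2; clear; lia.
  move=> /(_ d0) /eqP; rewrite -!mul2n !(exprM _ 2) d2.
  rewrite (eq_prim_root_expr (prim_pow2 _ _ _ _ N2 N1)) gcdnC.
  rewrite !modn_small; [by move=> /eqP| |]; apply: leq_trans t_le => //.
(* Raising [xi ^+ v = - xi ^+ i] to the odd power [a.*2.+1] would give [1 = -1]. *)
- move=> i v; rewrite addr_eq0; apply: contraNneq wN1 => /(congr1 (fun z => z ^+ a.*2.+1)) /=.
  by rewrite (exprNn (_ ^+ i)) (exprS (-1)) sgn1 mulr1 mulN1r (exprAC _ v) (exprAC _ i) xD !expr1n => <-.
(* The [x]-th power sends even powers of [delta] to 1 and odd ones to -1. *)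
- move=> u j; apply: contraNneq wN1 => /(congr1 (fun z => z ^+ x)) /=.
  by rewrite (exprAC _ u.*2) (exprAC _ j.*2.+1) dx sgn1 exprS sgn1 mulr1 => <-.
Qed.

(* The three lengths *)
Local Close Scope ring_scope.

Theorem theorem1 (F : finFieldType) (p m r q e1 f1 e2 f2 l s t : nat) :
  prime p -> odd p -> 0 < m -> r = p ^ m -> q = r ^ 2 -> #|F| = q ->
  0 < e1 -> 0 < f1 -> 0 < e2 -> 0 < f2 ->
  q - 1 = e1 * f1 -> q - 1 = e2 * f2 ->
  2 <= l -> e1 = 2 ^ l %[mod 2 ^ l.+1] -> 2 ^ l %| e2 ->
  (2 * e2) %| e1 * (r - 1) -> e1 %| e2 * (r + 1) ->
  1 <= s <= e1 %/ gcdn e1 e2 -> 1 <= t <= e2 %/ gcdn e1 e2 ->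
  4 %| (s - 1) * (r + 1) ->
  (~~ odd (s * f1 + t * f2) -> exists_MDS_self_dual F (s * f1 + t * f2)) /\
  (odd (s * f1 + t * f2) -> exists_MDS_self_dual F (s * f1 + t * f2).+1) /\
  (~~ odd (s * f1 + t * f2) -> exists_MDS_self_dual F (s * f1 + t * f2).+2).
Proof.
move=> pr_p odd_p m_gt0 rE -> cardF _ f1_gt0 _ _ N1 N2 l_ge2 e1_mod e2_dvd.
move=> e2_e1 e1_e2 /andP[s_gt0 s_le] /andP[_ t_le] sgn.
have [h [cardN even_h [A]]] := exists_union_cosets_deriv_exp_half pr_p odd_p m_gt0 rE cardF N1 N2
  l_ge2 e1_mod e2_dvd e2_e1 e1_e2 s_le t_le sgn.
have : (0 < s * f1 + t * f2)%N by rewrite addn_gt0 muln_gt0 s_gt0 f1_gt0.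
move: (s * f1 + t * f2)%N => n n_gt0 sizeA [P0 PA].
clear -n_gt0 sizeA P0 PA cardN even_h; split=> [evenn|]; last split=> [oddn|evenn].
- rewrite -(even_halfK evenn).
  apply: (exists_MDS_self_dual_half (A := A) cardN even_h); last by move=> a /PA[].
    by lia.
  by left; rewrite sizeA even_halfK.
- have -> : n.+1 = (n.+1)./2.*2 by lia.
  apply: (exists_MDS_self_dual_half (A := A) cardN even_h); last by move=> a /PA[].
    by lia.
  by right; lia.
(* Adjoining 0 and the point at infinity supplies the two extra coordinates. *)
- have -> : n.+2 = (n.+2)./2.*2 by lia.
  apply: (exists_MDS_self_dual_half (A := 0%R :: A) cardN even_h) => //.
    by right => /=; lia.
  (* The derivative of ['X * P] is [P(0)] at 0 and [a * P'(a)] at a root [a] of [P]. *)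
  move=> a; rewrite big_cons subr0 derivM derivX mul1r !hornerE inE.
  have [-> _|_ /= /[dup] aA /PA[ah Pah]] := eqVneq a 0%R; first by rewrite mul0r addr0.
  have /rootP -> : root (\prod_(b <- A) ('X - b%:P))%R a by rewrite root_prod_XsubC.
  by rewrite add0r exprMn ah Pah mulr1.
Qed.
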